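(* For $p>1$ let $\operatorname{tamh}_{p',p}$ denote the inverse function of $$x\mapsto\operatorname{arctamh}_{p',p}(x)=\int_0^x\frac{dt}{(1-t^p)^{2/p}},\qquad 0\le x<1.$$ Then for each fixed $y\in(0,1]$ the function $p\mapsto\operatorname{tamh}_{p',p}(y)$ is logarithmically concave on the half-line $p>1$.
   Context: Here $p'=p/(p-1)$ is the conjugate exponent. For every $p>1$ one has $\sup_{0\le x<1}\operatorname{arctamh}_{p',p}(x)>1$ (possibly $+\infty$), so $\operatorname{tamh}_{p',p}(y)\in(0,1)$ is defined for all $p>1$ whenever $y\in(0,1]$. A positive function $f$ on an interval is logarithmically concave if $\log f$ is concave, i.e. $f(\lambda a+(1-\lambda)b)\ge f(a)^\lambda f(b)^{1-\lambda}$ for all $a,b$ in the interval and $\lambda\in[0,1]$. *)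

(* Defs.v *)
From HB Require Import structures.
From mathcomp Require Import all_boot all_order all_algebra.
From mathcomp Require Import all_classical all_reals all_analysis.

Set Implicit Arguments.
Unset Strict Implicit.
Unset Printing Implicit Defensive.

Import Order.TTheory GRing.Theory Num.Theory.
Import numFieldNormedType.Exports.

Local Open Scope classical_set_scope.
Local Open Scope ring_scope.

(* [arctamh p] and [tamh p] stand for arctamh_{p',p} and tamh_{p',p}, where
   p' = p / (p - 1) is the exponent conjugate to p. *)

Definition arctamh {R : realType} (p x : R) : R :=
  \int[lebesgue_measure]_(t in `[0, x]) ((1 - t `^ p) `^ (2 / p))^-1.

(* The inverse of arctamh p on [0, 1[. Outside the range of arctamh p the value
   is 0, which is also arctamh^-1(0); hence, for y != 0, 0 < tamh p y holds
   exactly when y is in the range of arctamh p on [0, 1[. *)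
Definition tamh {R : realType} (p : R) : R -> R :=
  'pinv_(fun=> 0) `[0, 1[ (arctamh p).

Definition log_concave_on {R : realType} (I : interval R) (f : R -> R) : Prop :=
  {in I, forall a, 0 < f a} /\
  {in I &, forall a b : R, forall l : R, 0 <= l <= 1 ->
    f a `^ l * f b `^ (1 - l) <= f (l * a + (1 - l) * b)}.

(* Main.v *)
Require Import Defs.
From HB Require Import structures.
From mathcomp Require Import all_boot all_order all_algebra.
From mathcomp Require Import all_classical all_reals all_analysis.
From mathcomp Require Import ring lra.

Set Implicit Arguments.
Unset Strict Implicit.
Unset Printing Implicit Defensive.

Import Order.TTheory GRing.Theory Num.Theory.
Import numFieldNormedType.Exports.

Local Open Scope classical_set_scope.
Local Open Scope ring_scope.

(** The reason behind the theorem is that, in logarithmic coordinates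
    [x = expR u], the function [(p, u) |-> arctamh p (expR u)] is jointly
    convex.  Its sublevel set at height [y] is then a convex region, and
    [u = ln (tamh p y)] is the upper boundary of that region, hence a concave
    function of [p].

    The convexity is inherited from the integrand.  The substitution
    [t = x * s] turns [arctamh p x] into an integral over the fixed interval
    [[0, 1]] of [x / pcompl p (x * s) ^+ 2], where
    [pcompl p z = (1 - z `^ p) `^ p^-1] is the second coordinate of the point of
    the curve [z `^ p + w `^ p = 1] with first coordinate [z].  By the
    arithmetic-geometric mean inequality a log-convex function is convex, so it
    is enough that [(p, ln z) |-> - ln (pcompl p z)] is convex.  This function
    is [r * L (v / r)] at [r = p^-1], [v = - ln z], where
    [L q = - ln (1 - expR (- q))] is nonnegative, nonincreasing and convex.  The
    perspective [r * L (v / r)] is therefore jointly convex in [(r, v)] and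
    nondecreasing in [r], and it stays convex after substitution of the convex
    function [p^-1] for [r].  [pcompl_log_concave] carries out this argument in
    multiplicative form, where the convexity of [L] is the two-term Hoelder
    inequality [powR_geomean_onem]; [arctamh_convex] integrates the result.

    That [tamh p y] lies strictly between 0 and 1 for [0 < y <= 1] comes from
    the intermediate value theorem: the integrand is at least 1 everywhere and
    is bounded below by a constant [c > 1] on the upper half of the interval, so
    [arctamh p] reaches the value 1 before the end point ([arctamh_ge1]). *)

(** * Weighted means of real powers *)

Lemma powR_AMGM {R : realType} (l x y : R) : 0 <= l <= 1 -> 0 <= x -> 0 <= y ->
  x `^ l * y `^ (1 - l) <= l * x + (1 - l) * y.
Proof.
move=> /andP[l0 l1] x0 y0.
have [->|ln0] := eqVneq l 0.
  by rewrite powRr0 subr0 powRr1// mul0r add0r !mul1r.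
have [->|ln1] := eqVneq l 1.
  by rewrite subrr powRr0 powRr1// mul0r addr0 mulr1 mul1r.
have lp : 0 < l by rewrite lt_neqAle eq_sym ln0.
have mp : 0 < 1 - l by rewrite subr_gt0 lt_neqAle ln1.
have := @conjugate_powR R (x `^ l) (y `^ (1 - l)) l^-1 (1 - l)^-1.
rewrite !powR_ge0 !invr_gt0 !invrK subrKC => /(_ isT isT lp mp erefl).
by rewrite -!powRrM !mulfV ?gt_eqF// !powRr1// ![_ * l]mulrC ![_ * (1 - l)]mulrC.
Qed.

(** Equivalent to the concavity of [v |-> ln (1 - expR (- v))]: the two
    geometric means of [x, y] and of [1 - x, 1 - y] are bounded by arithmetic
    means that add up to 1. *)
Lemma powR_geomean_onem {R : realType} (l x y : R) : 0 <= l <= 1 ->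
  0 <= x <= 1 -> 0 <= y <= 1 ->
  (1 - x) `^ l * (1 - y) `^ (1 - l) <= 1 - x `^ l * y `^ (1 - l).
Proof.
move=> l01 /andP[x0 x1] /andP[y0 y1].
have h1 := powR_AMGM l01 x0 y0.
have : (1 - x) `^ l * (1 - y) `^ (1 - l) <= l * (1 - x) + (1 - l) * (1 - y).
  by apply: powR_AMGM; rewrite ?subr_ge0.
lra.
Qed.

Lemma conv_gt0 {R : realType} (l a b : R) : 0 <= l <= 1 -> 0 < a -> 0 < b ->
  0 < l * a + (1 - l) * b.
Proof.
move=> /andP[l0 l1] a0 b0.
have [->|ln0] := eqVneq l 0; first by rewrite mul0r add0r subr0 mul1r.
rewrite ltr_pwDl ?mulr_ge0 ?subr_ge0 ?(ltW b0)// mulr_gt0//.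
by rewrite lt_neqAle eq_sym ln0.
Qed.

(** The gap, multiplied by [l * a + (1 - l) * b], is
    [l * (1 - l) * (a - b) ^+ 2 / (a * b)]. *)
Lemma invr_convex {R : realType} (l a b : R) : 0 <= l <= 1 -> 0 < a -> 0 < b ->
  (l * a + (1 - l) * b)^-1 <= l / a + (1 - l) / b.
Proof.
move=> l01 a0 b0; have /andP[l0 l1] := l01.
have c0 := conv_gt0 l01 a0 b0.
rewrite -[leLHS]mul1r ler_pdivrMr// -subr_ge0.
have -> : (l / a + (1 - l) / b) * (l * a + (1 - l) * b) - 1 =
   l * (1 - l) * (a - b) ^+ 2 / (a * b).
  by field; rewrite !gt_eqF.
apply: divr_ge0; last by rewrite ltW ?mulr_gt0.
by rewrite mulr_ge0 ?sqr_ge0// mulr_ge0 ?subr_ge0.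
Qed.

Lemma powR_lt1 {R : realType} (p z : R) : 0 < p -> 0 <= z < 1 -> z `^ p < 1.
Proof.
move=> p0 /andP[z0 z1].
by have := gt0_ltr_powR p0 z0 ler01 z1; rewrite powR1.
Qed.

Lemma powRMpowR {R : realType} (u v s t r : R) :
  (u `^ s * v `^ t) `^ r = u `^ (s * r) * v `^ (t * r).
Proof. by rewrite (powRrM u s) (powRrM v t) powRM// powR_ge0. Qed.

Lemma geomean_lt1 {R : realType} (l x y : R) : 0 <= l <= 1 ->
  0 <= x < 1 -> 0 <= y < 1 -> x `^ l * y `^ (1 - l) < 1.
Proof.
move=> l01 /andP[x0 x1] /andP[y0 y1].
apply: le_lt_trans (powR_AMGM l01 x0 y0) _.
have : 0 < l * (1 - x) + (1 - l) * (1 - y) by apply: conv_gt0; rewrite ?subr_gt0.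
lra.
Qed.

(** * The integrand and its convexity *)

Definition pcompl {R : realType} (p z : R) : R := (1 - z `^ p) `^ p^-1.

(** Joint convexity of a perspective function, written multiplicatively.  With
    [r] the weighted mean of [a^-1] and [b^-1], and [t] the share of [a^-1] in
    it, the left-hand side is a geometric mean of [1 - x `^ a] and [1 - y `^ b]
    with weights [t] and [1 - t], raised to the power [r].
    [powR_geomean_onem] bounds it by the value of [(1 - z `^ r^-1) `^ r] at
    [z = x `^ l * y `^ (1 - l)], and that expression decreases in [r], which is
    at least the inverse of [l * a + (1 - l) * b] by [invr_convex]. *)
Lemma pcompl_log_concave {R : realType} (l a b x y : R) : 0 <= l <= 1 ->
  0 < a -> 0 < b -> 0 <= x < 1 -> 0 <= y < 1 ->
  pcompl a x `^ l * pcompl b y `^ (1 - l) <=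
    pcompl (l * a + (1 - l) * b) (x `^ l * y `^ (1 - l)).
Proof.
move=> l01 a0 b0 x01 y01; have /andP[l0 l1] := l01.
have /andP[x0 x1] := x01; have /andP[y0 y1] := y01.
have p0 := conv_gt0 l01 a0 b0.
have := invr_convex l01 a0 b0.
set p := _ + _ * b in p0 *; set r := _ + _ / b => pr.
have r0 : 0 < r by apply: lt_le_trans pr; rewrite invr_gt0.
have rn0 : r != 0 by rewrite gt_eqF.
pose t := l / a / r.
have tE : 1 - t = (1 - l) / b / r.
  by apply/eqP; rewrite subr_eq -mulrDl [X in X / r]addrC divff.
have t01 : 0 <= t <= 1.
  by rewrite -[t <= 1]subr_ge0 tE !divr_ge0// ?subr_ge0// ltW.
have tr : t * r = l / a by rewrite /t divfK.
have tr' : (1 - t) * r = (1 - l) / b by rewrite tE divfK.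
clearbody t r p; clear tE.
have X1 := powR_lt1 a0 x01; have Y1 := powR_lt1 b0 y01.
have X0 := powR_ge0 x a; have Y0 := powR_ge0 y b.
have Wr : ((x `^ a) `^ t * (y `^ b) `^ (1 - t)) `^ r = x `^ l * y `^ (1 - l).
  rewrite powRMpowR tr tr' -(powRrM x a) -(powRrM y b).
  by rewrite [a * _]mulrC [b * _]mulrC !divfK ?gt_eqF.
have -> : pcompl a x `^ l * pcompl b y `^ (1 - l) =
    ((1 - x `^ a) `^ t * (1 - y `^ b) `^ (1 - t)) `^ r.
  rewrite powRMpowR tr tr' [l / a]mulrC [(1 - l) / b]mulrC.
  by rewrite (powRrM _ a^-1 l) (powRrM _ b^-1 (1 - l)).
have w0 : 0 <= x `^ l * y `^ (1 - l) by rewrite mulr_ge0 ?powR_ge0.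
have w1 := geomean_lt1 l01 x01 y01.
move: (x `^ a) (y `^ b) (x `^ l * y `^ (1 - l)) X0 X1 Y0 Y1 Wr w0 w1.
move=> X Y w X0 X1 Y0 Y1 Wr w0 w1.
have := powR_geomean_onem t01 (introT andP (conj X0 (ltW X1)))
  (introT andP (conj Y0 (ltW Y1))).
have : 0 <= X `^ t * Y `^ (1 - t) by rewrite mulr_ge0 ?powR_ge0.
have : 0 <= (1 - X) `^ t * (1 - Y) `^ (1 - t) by rewrite mulr_ge0 ?powR_ge0.
move: (X `^ t * Y `^ (1 - t)) ((1 - X) `^ t * (1 - Y) `^ (1 - t)) Wr.
move=> W V Wr V0 W0 VW.
have wp1 : w `^ p < 1 by rewrite powR_lt1// w0.
(* W is the power 1 / r of w, and 1 / r <= p while w <= 1. *)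
have wW : w `^ p <= W.
  rewrite -[W]powRr1// -(mulfV rn0) powRrM Wr.
  have [->|wn0] := eqVneq w 0; first by rewrite powR0 ?gt_eqF ?powR_ge0.
  apply: ger_powR; first by rewrite lt_neqAle eq_sym wn0 w0 ltW.
  by rewrite -[p]invrK lef_pV2 ?posrE ?invr_gt0.
apply: (@le_trans _ _ ((1 - w `^ p) `^ r)).
  apply: ge0_ler_powR; rewrite ?nnegrE ?(ltW r0)//.
    by rewrite subr_ge0 ltW.
  by apply: le_trans VW _; rewrite lerD2l lerN2.
by apply: ger_powR pr; rewrite subr_gt0 wp1 gerBl powR_ge0.
Qed.

Definition arctamh_integrand {R : realType} (p t : R) : R :=
  ((1 - t `^ p) `^ (2 / p))^-1.

Lemma arctamh_integrandE {R : realType} (p t : R) :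
  arctamh_integrand p t = (pcompl p t ^+ 2)^-1.
Proof.
rewrite /arctamh_integrand /pcompl -powR_mulrn ?powR_ge0//.
by rewrite -powRrM [p^-1 * _]mulrC.
Qed.

Lemma pcompl_gt0 {R : realType} (p z : R) : 0 < p -> 0 <= z < 1 -> 0 < pcompl p z.
Proof. by move=> p0 z01; rewrite powR_gt0// subr_gt0 powR_lt1. Qed.

(** For fixed [t], the function [x * arctamh_integrand p (x * t)] is log-convex
    in [(p, ln x)], being [x] divided by the square of a log-concave function;
    the arithmetic-geometric mean inequality makes it convex. *)
Lemma arctamh_integrand_convex {R : realType} (l a b x y t : R) : 0 <= l <= 1 ->
  0 < a -> 0 < b -> 0 <= x < 1 -> 0 <= y < 1 -> 0 <= t <= 1 ->
  let z := x `^ l * y `^ (1 - l) in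
  z * arctamh_integrand (l * a + (1 - l) * b) (z * t) <=
  l * (x * arctamh_integrand a (x * t)) +
  (1 - l) * (y * arctamh_integrand b (y * t)).
Proof.
move=> l01 a0 b0 /andP[x0 x1] /andP[y0 y1] /andP[t0 t1]; set z := _ * _ => /=.
have xt01 : 0 <= x * t < 1 by apply/andP; split; nra.
have yt01 : 0 <= y * t < 1 by apply/andP; split; nra.
have ztE : z * t = (x * t) `^ l * (y * t) `^ (1 - l).
  rewrite !powRM// mulrACA -powRD; last by rewrite subrKC oner_eq0.
  by rewrite subrKC powRr1.
have := pcompl_log_concave l01 a0 b0 xt01 yt01; rewrite -ztE.
have Nx := pcompl_gt0 a0 xt01; have Ny := pcompl_gt0 b0 yt01.
rewrite !arctamh_integrandE.
move: (pcompl a (x * t)) (pcompl b (y * t)) (pcompl _ (z * t)) Nx Ny.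
move=> u v w u0 v0 uvw.
have uv0 : 0 < u `^ l * v `^ (1 - l) by rewrite mulr_gt0 ?powR_gt0.
apply: le_trans (powR_AMGM l01 _ _); last 2 first.
- by rewrite divr_ge0// sqr_ge0.
- by rewrite divr_ge0// sqr_ge0.
rewrite !powRM ?invr_ge0 ?sqr_ge0// mulrACA ler_wpM2l ?mulr_ge0 ?powR_ge0//.
have E q s : 0 < q -> (q ^+ 2)^-1 `^ s = ((q `^ s) ^+ 2)^-1.
  move=> q0; rewrite !expr2 !invfM powRM ?invr_ge0 ?(ltW q0)//.
  by rewrite -(powR_inv1 (ltW q0)) powRAC powR_inv1 ?powR_ge0.
rewrite !E// -invfM -exprMn lef_pV2 ?posrE ?exprn_gt0//; last first.
  exact: lt_le_trans uvw.
by rewrite ler_pXn2r// nnegrE ltW//; exact: lt_le_trans uvw.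
Qed.

(** * The integral *)

Lemma continuous_powR {R : realType} (p x : R) : 0 < x ->
  {for x, continuous (@powR R ^~ p)}.
Proof.
move=> x0; apply/differentiable_continuous/derivable1_diffP.
by apply: derivable_powR; rewrite in_itv/= andbT.
Qed.

(** Continuity at 0 is only one-sided: on negative numbers [powR] is the
    constant 1. *)
Lemma within_continuous_powR {R : realType} (p c : R) : 0 < p -> 0 < c ->
  {within `[0, c], continuous (@powR R ^~ p)}.
Proof.
move=> p0 c0; apply/continuous_within_itvP => //; split.
- by move=> t /[!in_itv]/= /andP[t0 _]; exact: continuous_powR.
- by rewrite powR0 ?gt_eqF//; exact: powR_cvg0.
- by apply: cvg_at_left_filter; exact: continuous_powR.
Qed.

Lemma within_continuous_integrand {R : realType} (p c : R) : 0 < p ->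
  0 < c < 1 -> {within `[0, c], continuous (arctamh_integrand p)}.
Proof.
move=> p0 /andP[c0 c1]; apply/subspace_continuousP => t /= tc.
have t01 : 0 <= t < 1 by move: tc; rewrite in_itv/= => /andP[-> /le_lt_trans->].
have tp1 := powR_lt1 p0 t01.
apply: cvgV; first by rewrite gt_eqF// powR_gt0// subr_gt0.
have h : (1 - s `^ p) @[s --> within `[0, c] (nbhs t)] --> 1 - t `^ p.
  apply: cvgB; first exact: cvg_cst.
  by move: t {t01 tp1} tc; apply/subspace_continuousP; exact: within_continuous_powR.
have h2 : {for 1 - t `^ p, continuous (@powR R ^~ (2 / p))}.
  by apply: continuous_powR; rewrite subr_gt0.
exact: (cvg_comp _ _ h h2).
Qed.

Lemma within_continuous_scale {R : realType} (f : R -> R) (x : R) : 0 < x ->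
  {within `[0, x], continuous f} ->
  {within `[0, 1], continuous (fun t => x * f (x * t))}.
Proof.
move=> x0 /subspace_continuousP cf; apply/subspace_continuousP => t /=.
have unit_scale s : s \in `[0, 1] -> x * s \in `[0, x].
  by rewrite !in_itv/= => /andP[s0 s1]; rewrite mulr_ge0 ?(ltW x0)// ger_pMr.
move=> t01; apply: cvgM; first exact: cvg_cst.
apply: cvg_trans (cf _ (unit_scale _ t01)) => A /= fA.
have : \forall s \near t, x * s \in `[0, x] -> A (f (x * s)).
  exact: (@mulrl_continuous R x t _ fA).
by apply: filterS => s As s01; apply/As/unit_scale.
Qed.

Lemma Rintegral_scale {R : realType} (f : R -> R) (x : R) : 0 < x ->
  {within `[0, x], continuous f} ->
  \int[lebesgue_measure]_(t in `[0, x]) f t =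
  \int[lebesgue_measure]_(t in `[0, 1]) (x * f (x * t)).
Proof.
move=> x0 cf.
have dF (t : R) : is_derive t 1 (fun s => x * s) x.
  have := is_deriveZ x (is_derive_id t 1).
  by rewrite /GRing.scale/= mulr1.
have FE : (fun s : R => x * s)^`()%classic = cst x.
  by apply/funext => t; rewrite derive1E derive_val.
have cF : continuous (fun s : R => x * s) by exact: mulrl_continuous.
have := @integration_by_substitution_increasing R (fun s => x * s) f 0 1.
rewrite mulr0 mulr1 FE /Rintegral => ->//.
- by congr fine; apply: eq_integral => t _ /=; rewrite mulrC.
- by move=> s t _ _; rewrite ltr_pM2l.
- by move=> t _; exact: cst_continuous.
- exact: is_cvg_cst.
- exact: is_cvg_cst.
- split.
  + by move=> t _; have [] := dF t.
  + by apply: cvg_at_right_filter; exact: cF.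
  + by apply: cvg_at_left_filter; exact: cF.
Qed.

Lemma integrable_integrand {R : realType} (p c : R) : 0 < p -> 0 < c < 1 ->
  (@lebesgue_measure R).-integrable `[0, c] (EFin \o arctamh_integrand p).
Proof.
move=> p0 c01; apply: continuous_compact_integrable.
  exact: segment_compact.
exact: within_continuous_integrand.
Qed.

(** Applied with [m = 1], it gives the strict monotonicity of [arctamh p]; with
    [m > 1], the excess over the length that makes [arctamh p] reach 1. *)
Lemma arctamh_increment_ge {R : realType} (p x y m : R) : 0 < p ->
  0 <= x <= y -> 0 < y < 1 -> (forall t, x <= t <= y -> m <= arctamh_integrand p t) ->
  m * (y - x) <= arctamh p y - arctamh p x.
Proof.
move=> p0 /andP[x0 xy] y01 mf; have ify := integrable_integrand p0 y01.
have sub : `]x, y] `<=` `[0, y] by apply: subset_itv; rewrite bnd_simp.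
rewrite [leRHS](@Rintegral_itvB R _ (BLeft 0) (BRight y))//.
have -> : m * (y - x) = \int[lebesgue_measure]_(t in `]x, y]) (cst m t).
  rewrite Rintegral_cst//= lebesgue_measure_itv/= lte_fin.
  case: ltP => //= yx; suff -> : y = x by rewrite subrr.
  by apply/eqP; rewrite eq_le xy yx.
apply: le_Rintegral => //.
- have : (@lebesgue_measure R).-integrable `[0, y] (EFin \o cst m).
    apply: continuous_compact_integrable; first exact: segment_compact.
    exact/continuous_subspaceT/cst_continuous.
  by apply: integrableS.
- exact: integrableS ify.
- by move=> t /=; rewrite in_itv/= => /andP[/ltW xt ty]; apply: mf; rewrite xt.
Qed.

Lemma arctamh0 {R : realType} (p : R) : arctamh p 0 = 0.
Proof. by rewrite /arctamh set_itv1 Rintegral_set1. Qed.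

Lemma arctamh_integrand_homo {R : realType} (p s t : R) : 0 < p ->
  0 <= s <= t -> t < 1 -> arctamh_integrand p s <= arctamh_integrand p t.
Proof.
move=> p0 /andP[s0 st] t1; have t0 := le_trans s0 st.
have s1 := le_lt_trans st t1.
have tp : t `^ p < 1 by apply: powR_lt1 => //; rewrite t0.
have sp : s `^ p < 1 by apply: powR_lt1 => //; rewrite s0.
rewrite /arctamh_integrand lef_pV2 ?posrE; last 2 first.
- by rewrite powR_gt0// subr_gt0.
- by rewrite powR_gt0// subr_gt0.
apply: ge0_ler_powR.
- by rewrite divr_ge0// ltW.
- by rewrite nnegrE subr_ge0 ltW.
- by rewrite nnegrE subr_ge0 ltW.
by rewrite lerD2l lerN2; apply: ge0_ler_powR; rewrite ?nnegrE// ltW.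
Qed.

Lemma arctamh_integrand0 {R : realType} (p : R) : 0 < p ->
  arctamh_integrand p 0 = 1.
Proof. by move=> p0; rewrite /arctamh_integrand powR0 ?gt_eqF// subr0 powR1 invr1. Qed.

Lemma arctamh_lt {R : realType} (p : R) : 0 < p ->
  {in `[0, 1[ &, {homo arctamh p : x y / x < y}}.
Proof.
move=> p0 x y /[!in_itv]/= /andP[x0 _] /andP[y0 y1] xy.
rewrite -subr_gt0; apply: lt_le_trans (arctamh_increment_ge (m := 1) p0 _ _ _).
- by rewrite mul1r subr_gt0.
- by rewrite x0 ltW.
- by rewrite y1 (le_lt_trans x0).
move=> t /andP[xt ty]; rewrite -(arctamh_integrand0 p0).
by apply: arctamh_integrand_homo; rewrite ?lexx ?(le_trans x0)// (le_lt_trans ty).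
Qed.

(** Let [c > 1] be the value of the integrand at 1/2.  The interval [[0, 1/2]]
    contributes at least 1/2, and an interval of length [1/2 / c < 1/2] to the
    right of 1/2, where the integrand is at least [c], contributes the rest. *)
Lemma arctamh_ge1 {R : realType} (p : R) : 0 < p ->
  exists2 x, 0 < x < 1 & 1 <= arctamh p x.
Proof.
move=> p0.
have [h h0 h2] : exists2 h : R, 0 < h & h + h = 1 by exists 2^-1; lra.
have h01 : 0 <= h < 1 by lra.
have [c ch] : exists c, c = arctamh_integrand p h.
  by exists (arctamh_integrand p h).
have c1 : 1 < c.
  have hp1 : 0 < 1 - h `^ p by rewrite subr_gt0 powR_lt1.
  rewrite ch /arctamh_integrand invf_gt1; last by rewrite powR_gt0.
  suff : (1 - h `^ p) `^ (2 / p) < 1 `^ (2 / p) by rewrite powR1.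
  apply: gt0_ltr_powR.
  - by rewrite divr_gt0.
  - by rewrite nnegrE ltW.
  - by rewrite nnegrE.
  - by rewrite gtrBl powR_gt0.
have [x xE] : exists x, x = h + h / c by exists (h + h / c).
have c0 : 0 < c := lt_trans ltr01 c1.
have xh : c * (x - h) = h.
  by rewrite xE addrAC subrr add0r mulrCA divff ?mulr1 ?gt_eqF.
have hx : h < x by rewrite xE ltrDl divr_gt0.
have x1 : x < 1 by rewrite xE -h2 ltrD2l ltr_pdivrMr// ltr_pMr.
have x0 : 0 < x := lt_trans h0 hx.
exists x; first by rewrite x0 x1.
have lower : 1 * (h - 0) <= arctamh p h - arctamh p 0.
  apply: (arctamh_increment_ge p0).
  - by rewrite lexx ltW.
  - by rewrite h0; case/andP: h01.
  - move=> t /andP[t0 th]; rewrite -(arctamh_integrand0 p0).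
    by apply: (arctamh_integrand_homo p0); lra.
have upper : c * (x - h) <= arctamh p x - arctamh p h.
  apply: (arctamh_increment_ge p0).
  - by rewrite (ltW h0) ltW.
  - by rewrite x0 x1.
  - move=> t /andP[ht tx]; rewrite ch.
    by apply: (arctamh_integrand_homo p0); lra.
by move: lower upper; rewrite xh arctamh0; lra.
Qed.

(** The range of the strictly increasing function [arctamh p] on [[0, 1[]
    contains [[0, 1]], so the pseudo-inverse does not take its default value
    there. *)
Lemma arctamh_tamh {R : realType} (p y : R) : 0 < p -> 0 < y <= 1 ->
  0 < tamh p y < 1 /\ arctamh p (tamh p y) = y.
Proof.
move=> p0 /andP[y0 y1]; have [x x01 x1] := arctamh_ge1 p0.
have /andP[x0 xlt1] := x01.
have cF : {within `[0, x], continuous (arctamh p)}.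
  by apply: parameterized_integral_continuous; [exact: ltW | exact: integrable_integrand].
have [] := IVT (v := y) (ltW x0) cF.
  rewrite arctamh0; have x1' := lt_le_trans ltr01 x1.
  by rewrite /Order.min /Order.max x1' ltW// (le_trans y1).
move=> z /[!in_itv]/= /andP[z0 zx] Fz.
have zI : z \in `[0, 1[ by rewrite in_itv/= z0 (le_lt_trans zx).
have inj : {in `[0, 1[%classic &, injective (arctamh p)}.
  move=> u v /[!inE] /= ui vi uv.
  case: (ltgtP u v) => // /(arctamh_lt p0) => /(_ _ _)/[!(ui,vi)] /(_ isT isT);
    by rewrite uv ltxx.
have -> : tamh p y = z by rewrite /tamh -Fz pinvKV// inE.
split=> //; move: zI; rewrite in_itv/= => /andP[_ ->]; rewrite andbT.
rewrite lt_neqAle z0 andbT; apply/eqP => z0E.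
by move: y0; rewrite -Fz -z0E arctamh0 ltxx.
Qed.

Lemma arctamh_scaled {R : realType} (p x : R) : 0 < p -> 0 < x < 1 ->
  arctamh p x =
  \int[lebesgue_measure]_(t in `[0, 1]) (x * arctamh_integrand p (x * t)).
Proof.
move=> p0 x01; rewrite -Rintegral_scale//; first by case/andP: x01.
exact: within_continuous_integrand.
Qed.

Lemma integrable_scaled_integrand {R : realType} (p x : R) : 0 < p ->
  0 < x < 1 -> (@lebesgue_measure R).-integrable `[0, 1]
    (EFin \o (fun t => x * arctamh_integrand p (x * t))).
Proof.
move=> p0 x01; apply: continuous_compact_integrable.
  exact: segment_compact.
apply: within_continuous_scale; first by case/andP: x01.
exact: within_continuous_integrand.
Qed.

(** Joint convexity of [(p, u) |-> arctamh p (expR u)], by integration of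
    [arctamh_integrand_convex] over the interval [[0, 1]], which no longer
    depends on [x]. *)
Lemma arctamh_convex {R : realType} (l a b x y : R) : 0 <= l <= 1 ->
  0 < a -> 0 < b -> 0 < x < 1 -> 0 < y < 1 ->
  arctamh (l * a + (1 - l) * b) (x `^ l * y `^ (1 - l)) <=
  l * arctamh a x + (1 - l) * arctamh b y.
Proof.
move=> l01 a0 b0 x01 y01; have /andP[x0 x1] := x01; have /andP[y0 y1] := y01.
have p0 := conv_gt0 l01 a0 b0.
have xI : 0 <= x < 1 by rewrite ltW.
have yI : 0 <= y < 1 by rewrite ltW.
have z01 : 0 < x `^ l * y `^ (1 - l) < 1.
  by rewrite mulr_gt0 ?powR_gt0//= geomean_lt1.
have ix := integrable_scaled_integrand a0 x01.
have iy := integrable_scaled_integrand b0 y01.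
have iz := integrable_scaled_integrand p0 z01.
rewrite (arctamh_scaled p0 z01) (arctamh_scaled a0 x01) (arctamh_scaled b0 y01).
rewrite -(RintegralZl l _ ix)// -(RintegralZl (1 - l) _ iy)//.
rewrite -RintegralD//; [|exact: integrableZl ix|exact: integrableZl iy].
apply: le_Rintegral => //.
  by apply: (integrableD _ (integrableZl _ l ix) (integrableZl _ (1 - l) iy)).
move=> t /= /[!in_itv]/= t01.
exact: arctamh_integrand_convex.
Qed.

(** * Log-concavity of the inverse *)

Theorem theorem2 (R : realType) (y : R) (hy0 : 0 < y) (hy1 : y <= 1) :
  log_concave_on `]1, +oo[ (fun p : R => tamh p y).
Proof.
have y01 : 0 < y <= 1 by rewrite hy0.
have pos p : p \in `]1, +oo[ -> 0 < p.
  by rewrite in_itv/= andbT; exact: lt_trans.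
split=> [p /pos p0|a b /pos a0 /pos b0 l l01] /=.
  by have [/andP[]] := arctamh_tamh p0 y01.
have p0 := conv_gt0 l01 a0 b0.
have [xa01 Fa] := arctamh_tamh a0 y01.
have [xb01 Fb] := arctamh_tamh b0 y01.
have [xp01 Fp] := arctamh_tamh p0 y01.
have := arctamh_convex l01 a0 b0 xa01 xb01.
rewrite Fa Fb -mulrDl subrKC mul1r -[X in _ <= X]Fp.
move: (tamh a y) (tamh b y) (tamh _ y) xa01 xb01 xp01 => u v w u01 v01 w01.
have /andP[u0 u1] := u01; have /andP[v0 v1] := v01; have /andP[w0 w1] := w01.
(* Above w, the value at tamh of the mean exponent, arctamh would exceed y. *)
apply: contraTT; rewrite -!ltNge => /(arctamh_lt p0).
rewrite !in_itv/= (ltW w0) w1 geomean_lt1 ?(ltW u0) ?(ltW v0)// mulr_ge0 ?powR_ge0//.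
exact.
Qed.
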